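(* For real $q>-1$ and $x>0$ let $$V_q(x)=\frac{2e^{x^2}}{\Gamma(q+1)}\int_x^{\infty}e^{-t^2}(t^2-x^2)^q\,dt.$$ The following assertions are true for real $a,b,q$: (a) $V_q$ is strictly $(a,b)$-concave on $(0,\infty)$ for $a,b\leq 0$ and $q>-1$; (b) $V_q$ is strictly $(a,b)$-concave on $(0,\infty)$ for $b\leq 1$ and $q>-1\geq a$; (c) $V_q$ is strictly $(a,b)$-convex on $(0,\infty)$ for $a\geq 2$, $b\geq 1$ and $q\geq 0$; (d) $V_q$ is strictly $(a,b)$-convex on $(0,\infty)$ for $a\geq 2$, $b\geq 0$ and $q\geq 0$; (e) $V_q$ is strictly $(a,b)$-concave on $(0,\infty)$ for $a\leq 1$, $b\leq -1$ and $q\geq 0$.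
   Context: $\Gamma$ denotes the Euler gamma function. For $a\in\mathbb{R}$, $\alpha\in[0,1]$ and $x,y>0$, the (weighted) power mean of order $a$ is $$H_a(x,y)=\begin{cases}\left(\alpha x^a+(1-\alpha)y^a\right)^{1/a}, & a\neq 0,\\ x^{\alpha}y^{1-\alpha}, & a=0.\end{cases}$$ Let $I\subset(0,\infty)$ be an interval and $\varphi:I\to(0,\infty)$ continuous. For $a,b\in\mathbb{R}$, $\varphi$ is called $(a,b)$-convex if $\varphi(H_a(x,y))\leq H_b(\varphi(x),\varphi(y))$ for all $x,y\in I$ and all $\alpha\in[0,1]$ (the same weight $\alpha$ is used in both means), and $(a,b)$-concave if the reversed inequality holds. It is strictly $(a,b)$-convex (respectively strictly $(a,b)$-concave) if the corresponding inequality is strict whenever $x\neq y$ and $\alpha\in(0,1)$. *)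

(* Defs.v *)
From HB Require Import structures.
From mathcomp Require Import all_boot all_order all_algebra.
From mathcomp Require Import all_classical all_reals all_analysis.

Set Implicit Arguments.
Unset Strict Implicit.
Unset Printing Implicit Defensive.

Import Order.TTheory GRing.Theory Num.Theory.
Import numFieldNormedType.Exports.

Local Open Scope classical_set_scope.
Local Open Scope ring_scope.

(* Euler's integral; it represents the gamma function for z > 0 only. *)
Definition Gamma {R : realType} (z : R) : R :=
  \int[lebesgue_measure]_(t in `]0, +oo[) (t `^ (z - 1) * expR (- t)).

(* alpha is the weight of x; the mean is meant for x, y > 0. *)
Definition power_mean {R : realType} (a alpha x y : R) : R :=
  if a == 0 then x `^ alpha * y `^ (1 - alpha)
  else (alpha * x `^ a + (1 - alpha) * y `^ a) `^ a^-1.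

(* The functions for which (a, b)-convexity is defined: I is an interval
   contained in (0, +oo) and phi is a continuous map from I to (0, +oo). *)
Definition positive_continuous_on {R : realType} (I : set R) (phi : R -> R) :=
  [/\ is_interval I,
      I `<=` `]0, +oo[,
      forall x, I x -> 0 < phi x &
      {within I, continuous phi}].

(* For x = y or alpha in {0, 1} both sides are equal to each other, so the
   strict inequalities below include the corresponding non-strict ones. *)
Definition strictly_ab_convex {R : realType} (a b : R) (I : set R)
    (phi : R -> R) :=
  positive_continuous_on I phi /\
  forall x y alpha : R, I x -> I y -> x <> y -> 0 < alpha < 1 ->
    phi (power_mean a alpha x y) < power_mean b alpha (phi x) (phi y).

Definition strictly_ab_concave {R : realType} (a b : R) (I : set R)
    (phi : R -> R) :=
  positive_continuous_on I phi /\
  forall x y alpha : R, I x -> I y -> x <> y -> 0 < alpha < 1 ->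
    power_mean b alpha (phi x) (phi y) < phi (power_mean a alpha x y).

Definition V {R : realType} (q x : R) : R :=
  2 * expR (x ^+ 2) / Gamma (q + 1) *
  \int[lebesgue_measure]_(t in `]x, +oo[)
     (expR (- t ^+ 2) * (t ^+ 2 - x ^+ 2) `^ q).

(* Main.v *)
Require Import Defs.
From HB Require Import structures.
From mathcomp Require Import all_boot all_order all_algebra.
From mathcomp Require Import all_classical all_reals all_analysis.
From mathcomp Require Import measurable_realfun ring lra.

Import Order.TTheory GRing.Theory Num.Theory.
Import numFieldNormedType.Exports.

Local Open Scope classical_set_scope.
Local Open Scope ring_scope.

(** The substitution s = t^2 - x^2 turns V into a moment of a gamma variable: with

      I_p(z) = int_0^oo e^(-s) s^q (z + s)^(-p) ds,

    one has V_q(x) = I_(1/2)(x^2) / Gamma(q + 1) ([V_momentE]). Two rules govern these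
    moments: I_p' = - p I_(p+1) ([is_derive_moment]), and the three-term recurrence that
    integration by parts gives ([moment_recurrence]).

    V is decreasing and power means increase with their order ([power_mean_le]), so
    concavity passes to smaller orders and convexity to larger ones. It is enough to treat
    the pairs (0, 0), (-1, 1) and (1, -1) for concavity and (2, 0) for convexity; the latter
    gives both convexity assertions. Conjugating by ln, by the inverse or by the square,
    each of the four becomes the ordinary strict convexity or concavity of a function of
    one variable, that is, the strict monotonicity of its derivative:

    - (0, 0): ln V(e^w) is concave, because z I_(3/2) / I_(1/2) increases; by the
      recurrence this is the Cauchy-Schwarz inequality I_(1/2)^2 < I_(-1/2) I_(3/2);
    - (-1, 1): V(1/u) is concave, because z I_(5/2) < I_(3/2);
    - (2, 0): ln V(sqrt z) is convex, by Cauchy-Schwarz I_(3/2)^2 < I_(1/2) I_(5/2);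
    - (1, -1): 1/V is convex when q >= 0. By the recurrence, its second derivative has the
      sign of P = z I_(3/2)^2 + (z + q) I_(1/2) I_(3/2) - I_(1/2)^2. The function
      I_(1/2) P e^(-z) z^(-q) has a negative derivative and a nonnegative lower limit at
      infinity, so it is positive, and so is P ([reciprocal_discriminant_gt0]). *)

(** * Integrals over a half-line *)

Section HalfLineIntegrals.
Context {R : realType}.
Notation mu := (@lebesgue_measure R).

Lemma half_line_exhaustion (x : R) (a b : R^nat) :
  (forall n, x < a n) -> a n @[n --> \oo] --> x -> b n @[n --> \oo] --> +oo ->
  `]x, +oo[%classic = \bigcup_n `[a n, b n]%classic.
Proof.
move=> xa cva cvb; apply/seteqP; split=> y /=.
  rewrite in_itv/= andbT => xy.
  have [n _ /(_ n (leqnn n)) /= /andP[ay yb]] :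
      \forall n \near \oo, (a n <= y) && (y <= b n).
    near=> n; apply/andP; split; first by near: n; exact: (cvgr_le x).
    by near: n; move/cvgryPge : cvb; apply.
  by exists n => //=; rewrite in_itv/= ay yb.
by move=> [n _] /=; rewrite !in_itv/= andbT => /andP[ay _]; exact: lt_le_trans ay.
Unshelve. all: by end_near. Qed.

(** The integrands below may be singular at the left endpoint, so neither the
    fundamental theorem of calculus nor substitution applies on the half-line
    itself: both are used on compact segments exhausting it, and monotone
    convergence passes to the limit. *)
Lemma ge0_integral_half_line_cvg (x : R) (a b : R^nat) (f : R -> R) :
  (forall n, x < a n) -> nonincreasing_seq a -> nondecreasing_seq b ->
  a n @[n --> \oo] --> x -> b n @[n --> \oo] --> +oo ->
  measurable_fun `]x, +oo[ f -> (forall y : R, x < y -> 0 <= f y) ->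
  (\int[mu]_(y in `[a n, b n]) (f y)%:E)%E @[n --> \oo] -->
  (\int[mu]_(y in `]x, +oo[) (f y)%:E)%E.
Proof.
move=> xa na nb cva cvb mf f0; rewrite (half_line_exhaustion _ _ _ xa cva cvb).
apply: ge0_nondecreasing_set_cvg_integral => //.
- move=> m n mn; apply/subsetPset => y /=; rewrite !in_itv/= => /andP[ay yb].
  by rewrite (le_trans (na _ _ mn))//= (le_trans yb)//; exact: nb.
- move=> n; apply/measurable_EFinP; apply: measurable_funS mf => // y /=; rewrite !in_itv/= andbT.
  by move=> /andP[+ _]; exact: lt_le_trans.
- move=> n y /=; rewrite in_itv/= => /andP[ay _].
  by rewrite lee_fin; apply: f0; exact: lt_le_trans ay.
Qed.

Lemma half_line_measurable (x : R) (f : R -> R) :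
  (forall y : R, x < y -> {for y, continuous f}) -> measurable_fun `]x, +oo[ f.
Proof.
move=> cf; apply: open_continuous_measurable_fun => //.
by move=> y; rewrite inE/= in_itv/= andbT; exact: cf.
Qed.

Lemma invSn_gt0 (n : nat) : 0 < n.+1%:R^-1 :> R.
Proof. by rewrite invr_gt0. Qed.

Lemma invSn_nonincreasing : nonincreasing_seq (fun n => n.+1%:R^-1 : R).
Proof. by move=> m n mn; rewrite lef_pV2 ?posrE// ler_nat. Qed.

Lemma Sn_nondecreasing : nondecreasing_seq (fun n => n.+1%:R : R).
Proof. by move=> m n mn; rewrite ler_nat. Qed.

Lemma cvg_invSn : (n.+1%:R^-1 : R) @[n --> \oo] --> (0 : R).
Proof. exact: cvg_harmonic. Qed.

Lemma cvg_Sn : (n.+1%:R : R) @[n --> \oo] --> +oo.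
Proof.
apply/cvgryPge => A; near=> n; rewrite (@le_trans _ _ n%:R) ?ler_nat//.
by near: n; exact: nbhs_infty_ger.
Unshelve. all: by end_near. Qed.

Lemma integral_segment_primitive (f K : R -> R) (n : nat) :
  (forall y : R, 0 < y -> {for y, continuous f}) ->
  (forall y : R, 0 < y -> is_derive y 1 K (f y)) ->
  (\int[mu]_(y in `[(n.+1%:R^-1)%R, n.+1%:R%R]) (f y)%:E =
     (K n.+1%:R - K n.+1%:R^-1)%R%:E)%E.
Proof.
move=> cf dK.
have K_cont y : 0 < y -> {for y, continuous K}.
  by move=> /dK dKy; apply: differentiable_continuous; apply/derivable1_diffP; exact: ex_derive.
case: n => [|n].
  by rewrite invr1 set_itv1 integral_set1 subrr.
have ab : (n.+2%:R^-1 < n.+2%:R :> R).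
  by rewrite (@lt_trans _ _ 1) ?invf_lt1 ?ltr1n.
rewrite (@continuous_FTC2 _ f K)// ?EFinB//.
- apply: continuous_in_subspaceT => y; rewrite inE/= in_itv/= => /andP[+ _].
  by move=> /(lt_le_trans (invSn_gt0 _)); exact: cf.
- split.
  + move=> y; rewrite in_itv/= => /andP[+ _].
    by move=> /(lt_trans (invSn_gt0 _)) /dK[].
  + by apply: cvg_at_right_filter; apply: K_cont; exact: invSn_gt0.
  + by apply: cvg_at_left_filter; apply: K_cont.
- move=> y; rewrite in_itv/= => /andP[+ _].
  by move=> /(lt_trans (invSn_gt0 _)) /dK dKy; rewrite derive1E derive_val.
Qed.

(** Since [f] is nonnegative, its integrals over the segments from [1/(n+1)] to [n+1]
    increase to the integral over the half-line, and each of them is a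
    difference of two values of [K]. *)
Lemma bounded_primitive_integrable (f K : R -> R) (M : R) :
  (forall y : R, 0 < y -> {for y, continuous f}) ->
  (forall y : R, 0 < y -> 0 <= f y) ->
  (forall y : R, 0 < y -> is_derive y 1 K (f y)) ->
  (forall y : R, 0 < y -> 0 <= K y <= M) ->
  mu.-integrable `]0, +oo[ (EFin \o f).
Proof.
move=> cf f0 dK KM.
have mf := half_line_measurable _ _ cf.
apply/integrableP; split; first exact/measurable_EFinP.
have -> : (\int[mu]_(x in `]0%R, +oo[) `|(EFin \o f) x| =
    \int[mu]_(x in `]0%R, +oo[) (f x)%:E)%E.
  apply: eq_integral => y; rewrite inE/= in_itv/= andbT => y0.
  by rewrite ger0_norm ?f0.
apply: (@le_lt_trans _ _ M%:E); last by rewrite ltry.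
have cvgI := @ge0_integral_half_line_cvg 0 (fun n => n.+1%:R^-1) (fun n => n.+1%:R)
  f invSn_gt0 invSn_nonincreasing Sn_nondecreasing cvg_invSn cvg_Sn mf f0.
rewrite -(cvg_lim _ cvgI)//; apply: lime_le; first by apply/cvg_ex; eexists; exact: cvgI.
apply: nearW => n; rewrite integral_segment_primitive// lee_fin.
have /andP[+ _] := KM _ (invSn_gt0 n); have /andP[_ +] := KM n.+1%:R (ltr0Sn _ _).
lra.
Qed.

(** The sign of [f] is arbitrary here, so dominated convergence (by [|f|])
    replaces the monotone convergence used for nonnegative integrands. *)
Lemma integrable_FTC_half_line (f K : R -> R) :
  (forall y : R, 0 < y -> {for y, continuous f}) ->
  (forall y : R, 0 < y -> is_derive y 1 K (f y)) ->
  mu.-integrable `]0, +oo[ (EFin \o f) ->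
  K n.+1%:R^-1 @[n --> \oo] --> 0 -> K n.+1%:R @[n --> \oo] --> 0 ->
  \int[mu]_(y in `]0, +oo[) f y = 0.
Proof.
move=> cf dK intf K0 Ky.
pose D n : set R := `[n.+1%:R^-1, n.+1%:R]%classic.
have DD n : D n `<=` `]0, +oo[.
  move=> y; rewrite /D/= !in_itv/= andbT => /andP[+ _].
  by apply: lt_le_trans; exact: invSn_gt0.
have mf := (measurable_EFinP _ _).1 (measurable_int _ intf).
have /fine_cvg : (K n.+1%:R - K n.+1%:R^-1)%:E @[n --> \oo] -->
    (fine (\int[mu]_(y in `]0%R, +oo[) (f y)%:E)%E)%:E.
  rewrite fineK; last exact: integrable_fin_num.
  rewrite (_ : (fun n => _) =
      fun n => (\int[mu]_(y in `]0%R, +oo[) ((f \_ (D n)) y)%:E)%E); last first.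
    apply/funext => n; rewrite -integral_segment_primitive//.
    rewrite integral_mkcond [RHS]integral_mkcond.
    apply: eq_integral => y _; rewrite /patch /=.
    case: ifPn => [yD|//]; first by rewrite (mem_set (DD _ _ (set_mem yD))).
    by case: ifPn.
  apply: (@dominated_cvg _ _ _ mu _ _ (fun n y => ((f \_ (D n)) y)%:E) _
    (fun y => (`|f y|)%:E)) => //.
  - move=> n; apply/measurable_EFinP.
    apply/measurable_restrict => //; first exact: measurable_itv.
    by apply: measurable_funS mf => //; exact: subIsetl.
  - move=> y; rewrite (half_line_exhaustion 0 (fun n => n.+1%:R^-1) (fun n => n.+1%:R)
      invSn_gt0 cvg_invSn cvg_Sn).
    move=> [m _ ym]; apply: cvg_near_cst; near=> n.
    rewrite patchE mem_set// /D.
    have mn : (m <= n)%N by near: n; exact: nbhs_infty_ge.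
    move: ym; rewrite /= !in_itv/= => /andP[my ym].
    by rewrite (le_trans (invSn_nonincreasing _ _ mn))//= (le_trans ym)// ler_nat.
  - exact: integrable_norm.
  - move=> n y _; rewrite lee_fin patchE; case: ifPn => // _.
    by rewrite normr0.
have : (K n.+1%:R - K n.+1%:R^-1) @[n --> \oo] --> (0 - 0 : R) by exact: cvgB.
rewrite subr0 => c1 c2; apply: (cvg_unique _ c2 c1) => //.
Unshelve. all: by end_near. Qed.

(** A nonnegative function with zero integral vanishes almost everywhere,
    whereas a half-line is not negligible. *)
Lemma Rintegral_half_line_gt0 (f : R -> R) (c : R) : 0 <= c ->
  mu.-integrable `]0, +oo[ (EFin \o f) ->
  (forall y : R, 0 < y -> 0 <= f y) -> (forall y, c < y -> 0 < f y) ->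
  0 < \int[mu]_(y in `]0, +oo[) f y.
Proof.
move=> c0 intf f0 fc.
have if0 : 0 <= \int[mu]_(y in `]0, +oo[) f y.
  by apply: Rintegral_ge0 => y /=; rewrite in_itv/= andbT; exact: f0.
rewrite lt_neqAle if0 andbT eq_sym; apply/negP => /eqP f_0.
have := integrable_fin_num _ intf => /(_ (measurable_itv _)) fin.
have /ae_eq_integral_abs : (\int[mu]_(y in `]0%R, +oo[) `|(EFin \o f) y| = 0)%E.
  transitivity (\int[mu]_(y in `]0%R, +oo[) (EFin \o f) y)%E.
    apply: eq_integral => y; rewrite inE/= in_itv/= andbT => y0.
    by rewrite ger0_norm ?f0.
  by rewrite -[LHS]fineK//; congr EFin.
move=> /(_ (measurable_itv _) (measurable_int _ intf)) [N [mN N0 subN]].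
have : (mu `]c, +oo[ <= mu N)%E.
  apply: le_measure; rewrite ?inE// => y /=; rewrite in_itv/= andbT => cy.
  apply: subN => /=; rewrite in_itv/= andbT => /(_ (le_lt_trans c0 cy)) [] fy.
  by have := fc _ cy; rewrite fy ltxx.
by rewrite [X in (_ <= X)%E]N0 lebesgue_measure_itv/= ltry addye.
Qed.

End HalfLineIntegrals.

(** * The gamma weight *)

Section GammaWeight.
Context {R : realType}.
Notation mu := (@lebesgue_measure R).

Lemma powRS (t a : R) : 0 < t -> t `^ (a + 1) = t * t `^ a.
Proof. by move=> t0; rewrite powRD ?(gt_eqF t0) ?implybT// powRr1 ?ltW// mulrC. Qed.

Lemma powR_continuous (a y : R) : 0 < y -> {for y, continuous (fun s => s `^ a)}.
Proof.
move=> y0; apply: differentiable_continuous; apply/derivable1_diffP.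
by apply: derivable_powR; rewrite in_itv/= y0.
Qed.

Lemma is_derive_powR_shift (z a s : R) : 0 < z + s ->
  is_derive s 1 (fun s => (z + s) `^ a) (a * (z + s) `^ (a - 1)).
Proof.
move=> zs; rewrite -[X in is_derive _ _ _ X]mulr1.
apply: (@is_derive1_comp _ (fun t => t `^ a) (fun s => z + s)).
  exact: is_derive1_powR.
have := is_deriveD (is_derive_cst z s (1 : R)) (is_derive_id s (1 : R)).
by rewrite add0r.
Qed.

Lemma is_derive_powR_shiftl (s a z : R) : 0 < z + s ->
  is_derive z 1 (fun z => (z + s) `^ a) (a * (z + s) `^ (a - 1)).
Proof.
move=> zs; under eq_fun do rewrite addrC; rewrite addrC.
by apply: is_derive_powR_shift; rewrite addrC.
Qed.

Lemma is_derive_expRN (s : R) : is_derive s 1 (fun s => expR (- s)) (- expR (- s)).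
Proof.
rewrite -mulrN1; exact: (@is_derive1_comp _ expR (fun s => - s)).
Qed.

(** This is [(1 + s/m)^m <= e^s] combined with [1 + s <= m (1 + s/m)]. *)
Lemma powR_expRN_le (m s : R) : 1 <= m -> 0 <= s ->
  (1 + s) `^ m * expR (- s) <= m `^ m.
Proof.
move=> m1 s0; have m0 : 0 < m by lra.
have h : 1 + s <= m * expR (s / m).
  apply: (@le_trans _ _ (m * (1 + s / m))); last by rewrite ler_pM2l// expR_ge1Dx.
  by rewrite mulrDr mulr1 mulrCA divff ?gt_eqF// mulr1 lerD2r.
rewrite expRN ler_pdivrMr ?expR_gt0//.
have -> : expR s = expR (s / m) `^ m by rewrite -expRM divfK ?gt_eqF.
rewrite -powRM ?expR_ge0 ?(ltW m0)//.
apply: (ge0_ler_powR (ltW m0)) => //; rewrite nnegrE; first lra.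
by rewrite mulr_ge0 ?expR_ge0// ltW.
Qed.

Definition gamma_weight (q s : R) : R := s `^ q * expR (- s).

Lemma gamma_weight_ge0 (q s : R) : 0 <= gamma_weight q s.
Proof. by rewrite mulr_ge0 ?powR_ge0 ?expR_ge0. Qed.

Lemma gamma_weight_gt0 (q s : R) : 0 < s -> 0 < gamma_weight q s.
Proof. by move=> s0; rewrite mulr_gt0 ?powR_gt0 ?expR_gt0. Qed.

Lemma gamma_weightS (q s : R) : 0 < s -> gamma_weight (q + 1) s = s * gamma_weight q s.
Proof. by move=> s0; rewrite /gamma_weight powRS// mulrA. Qed.

Lemma gamma_weight_continuous (q s : R) : 0 < s -> {for s, continuous (gamma_weight q)}.
Proof.
move=> s0; apply: continuousM; first exact: powR_continuous.
apply: (@continuous_comp _ _ _ (fun s : R => - s) expR); first exact: continuousN.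
exact: continuous_expR.
Qed.

(** The right-hand side has, up to a constant factor, the bounded primitive
    [(s / (1 + s))^(q + 1)]; this settles integrability for all [q > -1] at
    once, without splitting the half-line at 1. *)
Lemma gamma_weight_le (q s : R) : -1 < q -> 0 < s ->
  gamma_weight q s <= (q + 2) `^ (q + 2) * (s `^ q * (1 + s) `^ (- (q + 2))).
Proof.
move=> q1 s0; rewrite /gamma_weight mulrCA ler_pM2l ?powR_gt0//.
rewrite powRN ler_pdivlMr ?powR_gt0 ?addr_gt0// mulrC.
by apply: powR_expRN_le; lra.
Qed.

Lemma gamma_weight_integrable (q : R) : -1 < q ->
  mu.-integrable `]0, +oo[ (EFin \o gamma_weight q).
Proof.
move=> q1; have q0 : q + 1 != 0 by rewrite gt_eqF//; lra.
have mw := half_line_measurable 0 _ (gamma_weight_continuous q).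
pose f (s : R) := s `^ q * (1 + s) `^ (- (q + 2)).
(* A multiple of (s / (1 + s))^(q + 1), written as a product to differentiate it. *)
pose K (s : R) := (q + 1)^-1 * (s `^ (q + 1) * (1 + s) `^ (- (q + 1))).
have intf : mu.-integrable `]0, +oo[ (EFin \o f).
  apply: (@bounded_primitive_integrable _ f K (q + 1)^-1) => y y0.
  - apply: continuousM; first exact: powR_continuous.
    apply: (@continuous_comp _ _ _ (fun s : R => 1 + s) (fun s => s `^ (- (q + 2)))).
      by apply: continuousD; [exact: cst_continuous|exact: cvg_id].
    by apply: powR_continuous; lra.
  - by rewrite mulr_ge0// powR_ge0.
  - have d1 := @is_derive1_powR _ (q + 1) y y0.
    have d2 := @is_derive_powR_shift 1 (- (q + 1)) y (addr_gt0 ltr01 y0).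
    have d3 := is_deriveM d1 d2.
    have := @is_deriveZ _ _ _ _ (q + 1)^-1 _ _ _ d3.
    rewrite /K; move=> d4; apply: (is_derive_eq d4); rewrite /f /GRing.scale/=.
    have -> : - (q + 1) - 1 = - (q + 2) by lra.
    have -> : q + 1 - 1 = q by lra.
    have -> : - (q + 1) = - (q + 2) + 1 by lra.
    rewrite !powRS//; last lra.
    set A := y `^ q; set B := (1 + y) `^ (- (q + 2)).
    by field; lra.
  - rewrite /K; apply/andP; split.
      by rewrite !mulr_ge0 ?invr_ge0 ?powR_ge0//; lra.
    rewrite -[leRHS]mulr1 ler_pM2l ?invr_gt0; last lra.
    rewrite powRN ler_pdivrMr ?powR_gt0 ?mul1r//; last lra.
    by apply: ge0_ler_powR; rewrite ?nnegrE; lra.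
have := @integrableZl _ _ _ mu _ (measurable_itv _) ((q + 2) `^ (q + 2)) (EFin \o f) intf.
apply: le_integrable => //; first exact/measurable_EFinP.
move=> s /=; rewrite in_itv/= andbT => s0.
rewrite lee_fin !ger0_norm ?gamma_weight_ge0 ?mulr_ge0 ?powR_ge0//.
exact: gamma_weight_le.
Qed.

End GammaWeight.

(** * Shifted moments of the gamma weight *)

Section Moments.
Context {R : realType}.
Notation mu := (@lebesgue_measure R).
Implicit Types p q z s : R.

Lemma powRN_le p (x y : R) : 0 <= p -> 0 < x -> x <= y -> y `^ (- p) <= x `^ (- p).
Proof.
move=> p0 x0 xy; have y0 := lt_le_trans x0 xy.
rewrite !powRN lef_pV2 ?posrE ?powR_gt0//.
by apply: (ge0_ler_powR p0) => //; rewrite nnegrE ltW.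
Qed.

Definition shifted_weight q p z s : R := gamma_weight q s * (z + s) `^ (- p).

(** [moment q p z] is the unnormalised expectation of [(z + S)^(-p)] for [S]
    gamma distributed with parameter [q + 1]; it is denoted I_p(z) in the
    comments. *)
Definition moment q p z : R := \int[mu]_(s in `]0, +oo[) shifted_weight q p z s.

Lemma shifted_weight_ge0 q p z s : 0 <= shifted_weight q p z s.
Proof. by rewrite mulr_ge0 ?gamma_weight_ge0 ?powR_ge0. Qed.

Lemma shifted_weight_gt0 q p z s : 0 < z -> 0 < s -> 0 < shifted_weight q p z s.
Proof. by move=> z0 s0; rewrite mulr_gt0 ?gamma_weight_gt0 ?powR_gt0 ?addr_gt0. Qed.

Lemma shifted_weightB1 q p z s : 0 < z -> 0 < s ->
  shifted_weight q (p - 1) z s = (z + s) * shifted_weight q p z s.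
Proof.
move=> z0 s0; rewrite /shifted_weight (_ : - (p - 1) = - p + 1); last lra.
by rewrite powRS ?addr_gt0//; ring.
Qed.

Lemma shifted_weightD1 q p z s : 0 < z -> 0 < s ->
  shifted_weight q p z s = (z + s) * shifted_weight q (p + 1) z s.
Proof. by move=> z0 s0; rewrite -shifted_weightB1// addrK. Qed.

Lemma shifted_weight_continuous q p z s : 0 < z -> 0 < s ->
  {for s, continuous (shifted_weight q p z)}.
Proof.
move=> z0 s0; apply: continuousM; first exact: gamma_weight_continuous.
apply: (@continuous_comp _ _ _ (fun s : R => z + s) (fun s => s `^ (- p))).
  by apply: continuousD; [exact: cst_continuous|exact: cvg_id].
by apply: powR_continuous; rewrite addr_gt0.
Qed.

Lemma shifted_weight_measurable q p z : 0 < z ->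
  measurable_fun `](0 : R), +oo[ (shifted_weight q p z).
Proof. by move=> z0; apply: half_line_measurable => s s0; exact: shifted_weight_continuous. Qed.

Lemma shifted_weight_le q p z s : -1 <= p -> 0 < z -> 0 < s ->
  shifted_weight q p z s <=
    (1 + z) * z `^ (- (p + 1)) * (gamma_weight q s + gamma_weight (q + 1) s).
Proof.
move=> p1 z0 s0; rewrite gamma_weightS//.
have -> : p = p + 1 - 1 by lra.
rewrite shifted_weightB1// /shifted_weight subrK.
have hw := gamma_weight_gt0 q s s0.
have h1 : z + s <= (1 + z) * (1 + s).
  by have := mulr_gt0 z0 s0; lra.
have h2 : (z + s) `^ (- (p + 1)) <= z `^ (- (p + 1)).
  by apply: powRN_le; lra.
rewrite [leRHS](_ : _ = ((1 + z) * (1 + s)) * (gamma_weight q s * z `^ (- (p + 1)))); last ring.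
apply: ler_pM => //; rewrite ?mulr_ge0 ?powR_ge0 ?(ltW hw)//; first lra.
by rewrite ler_pM2l.
Qed.

Lemma shifted_weight_integrable q p z : -1 < q -> -1 <= p -> 0 < z ->
  mu.-integrable `]0, +oo[ (EFin \o shifted_weight q p z).
Proof.
move=> q1 p1 z0; have q2 : -1 < q + 1 by lra.
have := @integrableZl _ _ _ mu _ (measurable_itv _) ((1 + z) * z `^ (- (p + 1))) _
  (@integrableD _ _ _ mu _ (measurable_itv _) _ _
    (gamma_weight_integrable q q1) (gamma_weight_integrable (q + 1) q2)).
apply: le_integrable => //; first by apply/measurable_EFinP; exact: shifted_weight_measurable.
move=> s /=; rewrite in_itv/= andbT => s0.
rewrite lee_fin !ger0_norm ?shifted_weight_ge0 ?mulr_ge0 ?addr_ge0 ?gamma_weight_ge0 ?powR_ge0//;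
  [exact: shifted_weight_le|lra].
Qed.

Lemma moment_gt0 q p z : -1 < q -> -1 <= p -> 0 < z -> 0 < moment q p z.
Proof.
move=> q1 p1 z0; apply: (@Rintegral_half_line_gt0 _ _ 0) => //.
- exact: shifted_weight_integrable.
- by move=> s _; exact: shifted_weight_ge0.
- by move=> s s0; exact: shifted_weight_gt0.
Qed.

(** The recurrence and the two inequalities between moments below are each
    obtained by integrating a three-term combination of this form. *)
Lemma moment_lincomb q z (a b c p1 p2 p3 : R) : -1 < q -> 0 < z ->
  -1 <= p1 -> -1 <= p2 -> -1 <= p3 ->
  let f s := a * shifted_weight q p1 z s + b * shifted_weight q p2 z s +
             c * shifted_weight q p3 z s in
  mu.-integrable `]0, +oo[ (EFin \o f) /\
  \int[mu]_(s in `]0, +oo[) f s =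
    a * moment q p1 z + b * moment q p2 z + c * moment q p3 z.
Proof.
move=> q1 z0 h1 h2 h3 f.
have iZ (k p : R) : -1 <= p ->
    mu.-integrable `]0, +oo[ (EFin \o (fun s => k * shifted_weight q p z s)).
  by move=> hp; exact: (@integrableZl _ _ _ mu _ (measurable_itv _) k _
    (shifted_weight_integrable q p z q1 hp z0)).
have i12 := @integrableD _ _ _ mu _ (measurable_itv _) _ _ (iZ a p1 h1) (iZ b p2 h2).
have i123 := @integrableD _ _ _ mu _ (measurable_itv _) _ _ i12 (iZ c p3 h3).
split; first exact: i123.
rewrite /f RintegralD//; last exact: iZ.
rewrite RintegralD//; try exact: iZ.
by rewrite !RintegralZl//; exact: shifted_weight_integrable.
Qed.

(** For [t = I_p / I_(p+1)], the integral of [(z + s - t)^2] against the weight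
    of I_(p+1) is [I_(p-1) - I_p^2 / I_(p+1)]; strictness is the positivity of
    that square for large [s]. *)
Lemma moment_cauchy_schwarz q p z : -1 < q -> 0 <= p -> 0 < z ->
  moment q p z ^+ 2 < moment q (p - 1) z * moment q (p + 1) z.
Proof.
move=> q1 p0 z0.
have discriminant (a b c : R) : 0 < c ->
    0 < 1 * a + - (2 * (b / c)) * b + (b / c) ^+ 2 * c -> b ^+ 2 < a * c.
  move=> c0; rewrite (_ : _ + _ = a - b ^+ 2 / c); last by field; rewrite gt_eqF.
  by rewrite subr_gt0 ltr_pdivrMr.
have hm : -1 <= p - 1 by lra.
have h0 : -1 <= p by lra.
have hp : -1 <= p + 1 by lra.
pose t := moment q p z / moment q (p + 1) z.
apply: discriminant; first exact: moment_gt0.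
pose f s := 1 * shifted_weight q (p - 1) z s + - (2 * t) * shifted_weight q p z s +
  t ^+ 2 * shifted_weight q (p + 1) z s.
have [intf <-] : _ /\ \int[mu]_(s in `]0, +oo[) f s = _ :=
  @moment_lincomb q z 1 (- (2 * t)) (t ^+ 2) (p - 1) p (p + 1) q1 z0 hm h0 hp.
have fsq s : 0 < s -> f s = shifted_weight q (p + 1) z s * (z + s - t) ^+ 2.
  by move=> s0; rewrite /f shifted_weightB1// (shifted_weightD1 q p)//; ring.
apply: (@Rintegral_half_line_gt0 _ _ `|t|) => //.
  by move=> s s0; rewrite fsq// mulr_ge0 ?shifted_weight_ge0 ?sqr_ge0.
move=> s st; have s0 : 0 < s by apply: le_lt_trans st.
rewrite (fsq s s0) mulr_gt0 ?shifted_weight_gt0// exprn_gt0// subr_gt0.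
by rewrite (le_lt_trans (ler_norm t))// (lt_trans st)// ltrDr.
Qed.

(** The difference of the two sides is the integral of [s] against the weight of
    I_(p+1). *)
Lemma moment_shift_lt q p z : -1 < q -> -1 <= p -> 0 < z ->
  z * moment q (p + 1) z < moment q p z.
Proof.
move=> q1 p1 z0; have hp : -1 <= p + 1 by lra.
have solve (a b : R) : 0 < 1 * a + - z * b + 0 * b -> z * b < a by lra.
apply: solve.
pose f s := 1 * shifted_weight q p z s + - z * shifted_weight q (p + 1) z s +
  0 * shifted_weight q (p + 1) z s.
have [intf <-] : _ /\ \int[mu]_(s in `]0, +oo[) f s = _ :=
  @moment_lincomb q z 1 (- z) 0 p (p + 1) (p + 1) q1 z0 p1 hp hp.
have fs s : 0 < s -> f s = s * shifted_weight q (p + 1) z s.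
  by move=> s0; rewrite /f (shifted_weightD1 q p)//; ring.
apply: (@Rintegral_half_line_gt0 _ _ 0) => // s s0; rewrite fs//.
  by rewrite mulr_ge0 ?shifted_weight_ge0// ltW.
by rewrite mulr_gt0 ?shifted_weight_gt0.
Qed.

(** Differentiation under the integral sign, with a dominating function that is
    uniform on the interval from [z / 2] to [2 z]. *)
Lemma is_derive_moment q p z : -1 < q -> -1 <= p -> 0 < z ->
  is_derive z 1 (moment q p) (- p * moment q (p + 1) z).
Proof.
move=> q1 p1 z0; pose u := z / 2; pose v := 2 * z.
have u0 : 0 < u by rewrite divr_gt0.
have Iz : `]u, v[%classic z by rewrite /= in_itv/= /u /v; lra.
have I0 (x : R) : `]u, v[%classic x -> 0 < x.
  by rewrite /= in_itv/= => /andP[/(lt_trans u0)].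
have dk (x s : R) : `]u, v[%classic x -> `]0, +oo[%classic s ->
    is_derive x 1 (fun x => shifted_weight q p x s) (- p * shifted_weight q (p + 1) x s).
  move=> /I0 x0; rewrite /= in_itv/= andbT => s0.
  have d := @is_derive_powR_shiftl R s (- p) x (addr_gt0 x0 s0).
  have := @is_deriveZ _ _ _ _ (gamma_weight q s) _ _ _ d; move=> d'.
  apply: (is_derive_eq d'); rewrite /GRing.scale/= /shifted_weight opprD; ring.
pose G s := `|p| * (u `^ (- (p + 1)) * gamma_weight q s).
have G0 s : 0 <= G s by rewrite !mulr_ge0 ?powR_ge0 ?gamma_weight_ge0.
have iG : mu.-integrable `]0, +oo[ (EFin \o G).
  apply: (@integrableZl _ _ _ mu _ (measurable_itv _) `|p|
    (EFin \o (fun s => u `^ (- (p + 1)) * gamma_weight q s))).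
  by apply: (@integrableZl _ _ _ mu _ (measurable_itv _) _ (EFin \o gamma_weight q));
    exact: gamma_weight_integrable.
have d1E (x s : R) : `]u, v[%classic x -> `]0, +oo[%classic s ->
    partial1of2 (shifted_weight q p) x s = - p * shifted_weight q (p + 1) x s.
  by move=> xI s0; rewrite partial1of2E; have [_ ->] := dk _ _ xI s0.
have ub (x s : R) : `]u, v[%classic x -> `]0, +oo[%classic s ->
    `|partial1of2 (shifted_weight q p) x s| <= G s.
  move=> xI s0; rewrite d1E// normrM normrN /G.
  rewrite ler_wpM2l// ger0_norm ?shifted_weight_ge0// /shifted_weight mulrC.
  apply: ler_wpM2r; first exact: gamma_weight_ge0.
  move: xI s0; rewrite /= !in_itv/= andbT => /andP[ux xv] s0.
  by apply: powRN_le; lra.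
have ik (x : R) : `]u, v[%classic x -> mu.-integrable `]0, +oo[ (EFin \o shifted_weight q p x).
  by move=> /I0 x0; exact: shifted_weight_integrable.
have dd (x s : R) : `]u, v[%classic x -> `]0, +oo[%classic s ->
    derivable (fun x => shifted_weight q p x s) x 1.
  by move=> xI s0; have [] := dk _ _ xI s0.
apply: DeriveDef.
  exact: (@derivable_under_integral _ _ _ mu _ _ (measurable_itv _) _ _ _ Iz ik dd G G0 iG ub).
rewrite -derive1E.
rewrite (@differentiation_under_integral _ _ _ mu _ _ (measurable_itv _) _ _ _ Iz ik dd G G0 iG ub).
rewrite -RintegralZl//; last by apply: shifted_weight_integrable => //; lra.
by apply: eq_Rintegral => s; rewrite inE => s0; rewrite d1E.
Qed.

(** The first bound makes this boundary term vanish at 0 along [1/(n+1)], the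
    second one at infinity along [n+1]. *)
Lemma shifted_weight_decay q p z : -1 < q -> 0 <= p -> 0 < z ->
  exists2 M, 0 < M & forall s, 0 < s ->
    shifted_weight (q + 1) p z s <= M * s `^ (q + 1) /\
    shifted_weight (q + 1) p z s <= M * s^-1.
Proof.
move=> q1 p0 z0.
pose C : R := (q + 1 + 2) `^ (q + 1 + 2); pose c := (1 + z) * z `^ (- (p + 1)).
have C0 : 0 < C by rewrite powR_gt0; lra.
have c0 : 0 < c by rewrite mulr_gt0 ?powR_gt0//; lra.
exists (c * C); first exact: mulr_gt0.
move=> s s0; have s1 : 0 < 1 + s by lra.
have q2 : -1 < q + 1 by lra.
have h : shifted_weight (q + 1) p z s <= c * C * (s `^ (q + 1) * (1 + s) `^ (- (q + 2))).
  have := @shifted_weight_le (q + 1) p z s; rewrite -/c (gamma_weightS (q + 1))// => hk.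
  have {}hk := hk (le_trans (lerN10 _) p0) z0 s0; apply: (le_trans hk).
  rewrite -mulrA ler_pM2l//.
  rewrite (_ : - (q + 2) = - (q + 1 + 2) + 1); last lra.
  rewrite (powRS (1 + s))//.
  have := gamma_weight_le (q + 1) s q2 s0; rewrite -/C => hw.
  have := ler_wpM2l (ltW s1) hw; lra.
have cC := mulr_gt0 c0 C0.
split; apply: (le_trans h); rewrite ler_pM2l//.
  rewrite ler_piMr ?powR_ge0// powRN invf_le1 ?powR_gt0//.
  have : 1 `^ (q + 2) <= (1 + s) `^ (q + 2); last by rewrite powR1.
  by apply: ge0_ler_powR; rewrite ?nnegrE; lra.
rewrite (_ : - (q + 2) = - (q + 1) - 1); last lra.
rewrite powRB; last by rewrite (gt_eqF s1) implybT.
rewrite powRr1 ?(ltW s1)// powRN mulrA.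
apply: (@le_trans _ _ (1 + s)^-1); last by rewrite lef_pV2 ?posrE; lra.
rewrite ler_piMl ?invr_ge0 ?(ltW s1)// ler_pdivrMr ?powR_gt0// mul1r.
by apply: ge0_ler_powR; rewrite ?nnegrE; lra.
Qed.

(** Integration by parts: the function [s^(q+1) e^(-s) (z+s)^(-p)] vanishes at
    both ends of the half-line, so its derivative has integral zero, and that
    derivative is a combination of three shifted weights. *)
Lemma moment_recurrence q p z : -1 < q -> 0 <= p -> 0 < z ->
  p * (z * moment q (p + 1) z - moment q p z) =
  moment q (p - 1) z - (z + q + 1) * moment q p z.
Proof.
move=> q1 p0 z0.
have hm : -1 <= p - 1 by lra.
have h0 : -1 <= p by lra.
have hp : -1 <= p + 1 by lra.
have q0 : 0 < q + 1 by lra.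
have pE : - p - 1 = - (p + 1) by ring.
have pE' : - p = - (p + 1) + 1 by ring.
have solve (a b c : R) : (q + 1 + z - p) * b + -1 * a + p * z * c = 0 ->
    p * (z * c - b) = a - (z + q + 1) * b by lra.
apply: solve.
pose f s := (q + 1 + z - p) * shifted_weight q p z s + -1 * shifted_weight q (p - 1) z s +
  p * z * shifted_weight q (p + 1) z s.
have [intf <-] : _ /\ \int[mu]_(s in `]0, +oo[) f s = _ :=
  @moment_lincomb q z (q + 1 + z - p) (-1) (p * z) p (p - 1) (p + 1) q1 z0 h0 hm hp.
pose K s := shifted_weight (q + 1) p z s.
have cf s : 0 < s -> {for s, continuous f}.
  move=> s0; rewrite /f; apply: continuousD; first apply: continuousD;
    by apply: continuousM; [exact: cst_continuous|exact: shifted_weight_continuous].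
have dK s : 0 < s -> is_derive s 1 K (f s).
  move=> s0; have zs : 0 < z + s by rewrite addr_gt0.
  have d1 := is_deriveM (@is_derive1_powR _ (q + 1) s s0) (is_derive_expRN s).
  have d2 := is_deriveM d1 (@is_derive_powR_shift R z (- p) s zs).
  apply: (is_derive_eq d2); rewrite /f/= /GRing.scale/=.
  rewrite !fctE shifted_weightB1// (shifted_weightD1 q p)//.
  rewrite /shifted_weight /gamma_weight pE pE' !powRS// addrK.
  set A := s `^ q; set B := (z + s) `^ _; set C := expR _.
  ring.
have [M M0 KM] := shifted_weight_decay q p z q1 p0 z0.
have K0 s : 0 <= K s by exact: shifted_weight_ge0.
have cvgK0 : K n.+1%:R^-1 @[n --> \oo] --> 0.
  apply: (@squeeze_cvgr _ _ _ _ (cst 0) (fun n => M * (n.+1%:R^-1) `^ (q + 1))).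
  - by apply: nearW => n; rewrite K0/=; have [] := KM n.+1%:R^-1 (invSn_gt0 n).
  - exact: cvg_cst.
  - rewrite -[X in _ --> X](mulr0 M); apply: cvgMr.
    have /cvg_at_rightP := powR_cvg0 q0; apply; split; last exact: cvg_invSn.
    by move=> n; exact: invSn_gt0.
have cvgKy : K n.+1%:R @[n --> \oo] --> 0.
  apply: (@squeeze_cvgr _ _ _ _ (cst 0) (fun n => M * n.+1%:R^-1)).
  - by apply: nearW => n; rewrite K0/=; have [] := KM n.+1%:R (ltr0Sn _ _).
  - exact: cvg_cst.
  - by rewrite -[X in _ --> X](mulr0 M); apply: cvgMr; exact: cvg_invSn.
exact: integrable_FTC_half_line f K cf dK intf cvgK0 cvgKy.
Qed.

End Moments.

(** * Strict convexity from an increasing derivative *)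

Section StrictConvexity.
Context {R : realType}.

(** The mean value theorem on both sides of the barycentre. *)
Lemma strictly_increasing_derivative_convex (f f' : R -> R) (i : interval R) :
  (forall x, x \in i -> is_derive x 1 f (f' x)) ->
  {in i &, {homo f' : x y / x < y}} ->
  forall x y alpha : R, x \in i -> y \in i -> x <> y -> 0 < alpha < 1 ->
  f (alpha * x + (1 - alpha) * y) < alpha * f x + (1 - alpha) * f y.
Proof.
move=> df mf'.
have lt_case x y alpha : x \in i -> y \in i -> x < y -> 0 < alpha < 1 ->
    f (alpha * x + (1 - alpha) * y) < alpha * f x + (1 - alpha) * f y.
  move=> xi yi xy /andP[a0 a1]; set w := alpha * x + (1 - alpha) * y.
  have xw : x < w by rewrite /w; nra.
  have wy : w < y by rewrite /w; nra.
  have iI (u v z : R) : u \in i -> v \in i -> u <= z <= v -> z \in i.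
    by move=> ui vi uzv; apply: (@interval_is_interval _ i u v ui vi).
  have cont (u v : R) : u \in i -> v \in i -> {within `[u, v], continuous f}.
    move=> ui vi; apply: derivable_within_continuous => z; rewrite in_itv/= => uzv.
    by have [] := df z (iI _ _ _ ui vi uzv).
  have wi : w \in i by apply: (iI x y) => //; rewrite !ltW.
  have d (u v : R) : u \in i -> v \in i -> forall z, z \in `]u, v[ -> is_derive z 1 f (f' z).
    move=> ui vi z; rewrite in_itv/= => /andP[uz zv].
    by apply: df; apply: (iI u v) => //; rewrite !ltW.
  have [c + fc] := MVT xw (d _ _ xi wi) (cont _ _ xi wi).
  have [e + fe] := MVT wy (d _ _ wi yi) (cont _ _ wi yi).
  rewrite !in_itv/= => /andP[we ey] /andP[xc cw].
  have ce : f' c < f' e.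
    by apply: mf'; [apply: (iI x w)|apply: (iI w y)|apply: lt_trans we] => //; rewrite !ltW.
  have -> : f w = alpha * f w + (1 - alpha) * f w by ring.
  have wx : w - x = (1 - alpha) * (y - x) by rewrite /w; ring.
  have yw : y - w = alpha * (y - x) by rewrite /w; ring.
  rewrite wx in fc; rewrite yw in fe.
  have pos : 0 < alpha * (1 - alpha) * (y - x) * (f' e - f' c).
    by rewrite !mulr_gt0// subr_gt0.
  have -> : f y = f w + f' e * (alpha * (y - x)) by lra.
  have -> : f x = f w - f' c * ((1 - alpha) * (y - x)) by lra.
  by rewrite -subr_gt0; apply: (lt_le_trans pos); rewrite le_eqVlt; apply/orP; left; apply/eqP; ring.
move=> x y alpha xi yi /eqP; rewrite neq_lt => /orP[xy|yx] a01; first exact: lt_case.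
have h := lt_case _ _ (1 - alpha) yi xi yx; rewrite subKr in h.
rewrite addrC [ltRHS]addrC; apply: h.
by move: a01 => /andP[a0 a1]; apply/andP; split; lra.
Qed.

Lemma positive_derivative_increasing (f f' : R -> R) (i : interval R) :
  (forall x, x \in i -> is_derive x 1 f (f' x)) ->
  (forall x, x \in i -> 0 < f' x) -> {in i &, {homo f : x y / x < y}}.
Proof.
move=> df f'0 x y xi yi xy.
have iI (z : R) : x <= z <= y -> z \in i.
  by move=> xzy; apply: (@interval_is_interval _ i x y xi yi).
have d z : z \in `]x, y[ -> is_derive z 1 f (f' z).
  by rewrite in_itv/= => /andP[xz zy]; apply/df/iI; rewrite !ltW.
have [|c + fc] := MVT xy d.
  apply: derivable_within_continuous => z; rewrite in_itv/= => xzy.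
  by have [] := df z (iI _ xzy).
rewrite in_itv/= => /andP[xc cy]; rewrite -subr_gt0 fc mulr_gt0 ?subr_gt0//.
by apply/f'0/iI; rewrite !ltW.
Qed.

End StrictConvexity.

(** * Weighted power means *)

Section PowerMean.
Context {R : realType}.
Implicit Types a b alpha x y : R.

Lemma power_mean_gt0 a alpha x y : 0 < alpha < 1 -> 0 < x -> 0 < y ->
  0 < power_mean a alpha x y.
Proof.
move=> /andP[a0 a1] x0 y0; rewrite /power_mean; case: ifPn => _.
  by rewrite mulr_gt0 ?powR_gt0.
by rewrite powR_gt0// addr_gt0// mulr_gt0 ?powR_gt0// subr_gt0.
Qed.

Lemma power_meanZ a alpha c x y : 0 < alpha < 1 -> 0 < c -> 0 < x -> 0 < y ->
  power_mean a alpha (c * x) (c * y) = c * power_mean a alpha x y.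
Proof.
move=> /andP[a0 a1] c0 x0 y0; rewrite /power_mean !powRM ?(ltW c0) ?(ltW x0) ?(ltW y0)//.
case: ifPn => [_|an0].
  rewrite mulrACA -powRD ?(gt_eqF c0) ?implybT//.
  by rewrite addrC subrK powRr1 ?ltW.
have -> : alpha * (c `^ a * x `^ a) + (1 - alpha) * (c `^ a * y `^ a) =
   c `^ a * (alpha * x `^ a + (1 - alpha) * y `^ a) by ring.
rewrite powRM ?powR_ge0//; last first.
  by rewrite addr_ge0// mulr_ge0 ?powR_ge0//; lra.
by rewrite -powRrM divff// powRr1 ?ltW.
Qed.

Lemma power_mean_inv a alpha x y : 0 < alpha < 1 -> 0 < x -> 0 < y ->
  power_mean (- a) alpha x y = (power_mean a alpha x^-1 y^-1)^-1.
Proof.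
move=> /andP[a0 a1] x0 y0; rewrite /power_mean oppr_eq0.
have inv t b : 0 < t -> t^-1 `^ b = t `^ (- b).
  by move=> t0; rewrite -[in LHS]powR_inv1 ?ltW// -powRrM mulN1r.
case: (a == 0).
  by rewrite (inv _ alpha x0) (inv _ (1 - alpha) y0) !powRN invfM !invrK.
by rewrite (inv _ a x0) (inv _ a y0) invrN; exact: powRN.
Qed.

Lemma power_mean_le_pos a b alpha x y : 0 < a -> a <= b ->
  0 < alpha < 1 -> 0 < x -> 0 < y ->
  power_mean a alpha x y <= power_mean b alpha x y.
Proof.
move=> a0 ab /andP[al0 al1] x0 y0; have b0 := lt_le_trans a0 ab.
have powE t : (t `^ a) `^ (b / a) = t `^ b by rewrite -powRrM mulrC divfK ?gt_eqF.
have baE : b / a / b = a^-1 by rewrite mulrAC divff ?mul1r ?gt_eqF.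
have al1' : 0 <= 1 - alpha by rewrite subr_ge0 ltW.
rewrite /power_mean (gt_eqF a0) (gt_eqF b0).
set X := x `^ a; set Y := y `^ a.
have X0 : 0 < X by rewrite powR_gt0.
have Y0 : 0 < Y by rewrite powR_gt0.
have p1 : 1 <= b / a by rewrite ler_pdivlMr// mul1r.
have S0 : 0 <= alpha * X + (1 - alpha) * Y.
  by rewrite addr_ge0 ?mulr_ge0 ?(ltW X0) ?(ltW Y0) ?(ltW al0).
have : (alpha * X + (1 - alpha) * Y) `^ (b / a) <=
    alpha * X `^ (b / a) + (1 - alpha) * Y `^ (b / a).
  have := @convex_powR R _ p1 (Itv01 (ltW al0) (ltW al1)) X Y.
  rewrite !convRE/= /unstable.onem; apply; rewrite inE/= in_itv/= andbT ltW//.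
rewrite /X /Y !powE -/X -/Y => h.
have : ((alpha * X + (1 - alpha) * Y) `^ (b / a)) `^ b^-1 <=
   (alpha * x `^ b + (1 - alpha) * y `^ b) `^ b^-1.
  have ib0 : 0 <= b^-1 by rewrite invr_ge0 ltW.
  apply: (ge0_ler_powR ib0) => //; rewrite nnegrE ?powR_ge0//.
  by rewrite addr_ge0 ?mulr_ge0 ?powR_ge0 ?(ltW al0).
by rewrite -powRrM baE.
Qed.

Lemma power_mean0_le b alpha x y : 0 < b -> 0 < alpha < 1 -> 0 < x -> 0 < y ->
  power_mean 0 alpha x y <= power_mean b alpha x y.
Proof.
move=> b0 /andP[al0 al1] x0 y0.
rewrite /power_mean eqxx gt_eqF//.
have xb := powR_gt0 b x0; have yb := powR_gt0 b y0.
have := @concave_ln R (Itv01 (ltW al0) (ltW al1)) _ _ xb yb.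
rewrite !convRE/= /unstable.onem !ln_powR => h.
rewrite -ler_ln ?posrE ?powR_gt0 ?mulr_gt0 ?powR_gt0//; last first.
  by rewrite addr_gt0// mulr_gt0//; lra.
rewrite lnM ?posrE ?powR_gt0// !ln_powR ler_pdivlMl//.
by move: h; lra.
Qed.

(** For positive orders this is the convexity of [t |-> t^(b/a)] (and, from order
    0, the concavity of [ln]); negative orders reduce to positive ones by
    inverting the arguments, and 0 links the two ranges. *)
Lemma power_mean_le a b alpha x y : a <= b ->
  0 < alpha < 1 -> 0 < x -> 0 < y ->
  power_mean a alpha x y <= power_mean b alpha x y.
Proof.
move=> ab al x0 y0.
have ge0_le c d u v : 0 <= c -> c <= d -> 0 < u -> 0 < v ->
    power_mean c alpha u v <= power_mean d alpha u v.
  rewrite le_eqVlt => /predU1P[<-|c0]; last by move=> *; exact: power_mean_le_pos.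
  by rewrite le_eqVlt => /predU1P[<-//|d0] u0 v0; exact: power_mean0_le.
have [a0|a0] := leP 0 a; first exact: ge0_le.
have le0_le c d : d <= 0 -> c <= d -> power_mean c alpha x y <= power_mean d alpha x y.
  have ix0 : 0 < x^-1 by rewrite invr_gt0.
  have iy0 : 0 < y^-1 by rewrite invr_gt0.
  have invE e : power_mean e alpha x y = (power_mean (- e) alpha x^-1 y^-1)^-1.
    by rewrite -(power_mean_inv (- e) alpha x y al x0 y0) opprK.
  have pos e := power_mean_gt0 (- e) alpha x^-1 y^-1 al ix0 iy0.
  move=> d0 cd; rewrite (invE c) (invE d) (lef_pV2 (pos c) (pos d)).
  by apply: ge0_le; rewrite ?invr_gt0 ?oppr_ge0 ?lerN2.
have [b0|b0] := leP b 0; first exact: le0_le.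
apply: (@le_trans _ _ (power_mean 0 alpha x y)).
  by apply: le0_le => //; exact: ltW.
by apply: ge0_le => //; exact: ltW.
Qed.

Lemma power_mean1 alpha x y : 0 < alpha < 1 -> 0 < x -> 0 < y ->
  power_mean 1 alpha x y = alpha * x + (1 - alpha) * y.
Proof.
move=> /andP[a0 a1] x0 y0; rewrite /power_mean oner_eq0 invr1 !powRr1 ?ltW//.
by rewrite addr_gt0 ?mulr_gt0//; lra.
Qed.

Lemma power_meanN1 alpha x y : 0 < alpha < 1 -> 0 < x -> 0 < y ->
  power_mean (-1) alpha x y = (alpha * x^-1 + (1 - alpha) * y^-1)^-1.
Proof. by move=> al x0 y0; rewrite power_mean_inv// power_mean1 ?invr_gt0. Qed.

Lemma power_mean2_sqr alpha x y : 0 < alpha < 1 -> 0 < x -> 0 < y ->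
  power_mean 2 alpha x y ^+ 2 = alpha * x ^+ 2 + (1 - alpha) * y ^+ 2.
Proof.
move=> /andP[a0 a1] x0 y0; rewrite /power_mean pnatr_eq0/= !powR_mulrn ?ltW//.
rewrite -powR_mulrn ?powR_ge0// -powRrM mulVf ?pnatr_eq0// powRr1//.
by rewrite addr_ge0// mulr_ge0 ?sqr_ge0//; lra.
Qed.

Lemma power_mean0_expR alpha x y : 0 < x -> 0 < y ->
  power_mean 0 alpha x y = expR (alpha * ln x + (1 - alpha) * ln y).
Proof. by move=> x0 y0; rewrite /power_mean eqxx /powR !gt_eqF// expRD. Qed.

Lemma ln_power_mean0 alpha x y : 0 < x -> 0 < y ->
  ln (power_mean 0 alpha x y) = alpha * ln x + (1 - alpha) * ln y.
Proof. by move=> x0 y0; rewrite power_mean0_expR// expRK. Qed.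

End PowerMean.

(** * The integral V as a shifted moment *)

Section Representation.
Context {R : realType}.
Notation mu := (@lebesgue_measure R).

Lemma Gamma_gt0 (q : R) : -1 < q -> 0 < Gamma (q + 1).
Proof.
move=> q1; rewrite /Gamma addrK.
apply: (@Rintegral_half_line_gt0 _ (gamma_weight q) 0) => //.
- exact: gamma_weight_integrable.
- by move=> s _; exact: gamma_weight_ge0.
- by move=> s s0; exact: gamma_weight_gt0.
Qed.

(** The substitution [t = sqrt (x^2 + s)], made on segments that stay away from
    the endpoint since the integrands are unbounded there for negative [q]. *)
Lemma V_integralE (q x : R) : -1 < q -> 0 < x ->
  \int[mu]_(t in `]x, +oo[) (expR (- t ^+ 2) * (t ^+ 2 - x ^+ 2) `^ q) =
  expR (- x ^+ 2) / 2 * moment q (1 / 2) (x ^+ 2).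
Proof.
move=> q1 x0; pose z := x ^+ 2; have z0 : 0 < z by rewrite exprn_gt0.
pose G (t : R) := expR (- t ^+ 2) * (t ^+ 2 - x ^+ 2) `^ q.
pose F (s : R) := (z + s) `^ (1 / 2).
pose F' (s : R) := 1 / 2 * (z + s) `^ (- (1 / 2)).
pose k := expR (- x ^+ 2) / 2.
have k0 : 0 <= k by rewrite divr_ge0 ?expR_ge0.
have F_gt0 (s : R) : 0 <= s -> 0 < F s by move=> s0; rewrite powR_gt0; lra.
have half2 : 1 / 2 * 2%:R = 1 :> R by lra.
have F0 : F 0 = x.
  by rewrite /F addr0 /z -powR_mulrn ?ltW// -powRrM mulrC half2 powRr1 ?ltW.
have FF (s : R) : 0 <= s -> F s ^+ 2 = z + s.
  by move=> s0; rewrite -powR_mulrn ?powR_ge0// -powRrM half2 powRr1//; lra.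
have F_lt (s t : R) : 0 <= s -> s < t -> F s < F t.
  by move=> s0 st; apply: gt0_ltr_powR; rewrite ?nnegrE; lra.
have F_gtx (s : R) : 0 < s -> x < F s.
  move=> s0; have := F_lt 0 s (lexx _) s0; apply: le_lt_trans.
  by rewrite F0.
have dF (s : R) : 0 < s -> is_derive s 1 F (F' s).
  move=> s0; have := @is_derive_powR_shift R z (1 / 2) s (addr_gt0 z0 s0).
  by rewrite (_ : 1 / 2 - 1 = - (1 / 2)); last lra.
have F_cont (s : R) : 0 < s -> {for s, continuous F}.
  by move=> /dF[+ _] => /derivable1_diffP; exact: differentiable_continuous.
have F'_cont (s : R) : 0 < s -> {for s, continuous F'}.
  move=> s0; apply: continuousM; first exact: cst_continuous.
  apply: (@continuous_comp _ _ _ (fun s : R => z + s) (fun s => s `^ (- (1 / 2)))).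
    by apply: continuousD; [exact: cst_continuous|exact: cvg_id].
  by apply: powR_continuous; lra.
have F'E (s : R) : 0 < s -> F^`()%classic s = F' s.
  by move=> /dF[_]; rewrite derive1E.
have F1_cont (s : R) : 0 < s -> {for s, continuous (F^`()%classic)}.
  move=> s0; suff : F^`()%classic t @[t --> s] --> F^`()%classic s by [].
  rewrite F'E//.
  apply: cvg_trans (F'_cont _ s0); apply: near_eq_cvg; near=> t.
  by rewrite F'E//; near: t; exact: lt_nbhsr.
have G_cont (t : R) : x < t -> {for t, continuous G}.
  move=> xt; have t2 : {for t, continuous (fun t : R => t ^+ 2)} by exact: exprn_continuous.
  apply: continuousM.
    apply: (@continuous_comp _ _ _ (fun t : R => - t ^+ 2) expR); first exact: continuousN.
    exact: continuous_expR.
  apply: (@continuous_comp _ _ _ (fun t : R => t ^+ 2 - x ^+ 2) (fun s => s `^ q)).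
    by apply: continuousB => //; exact: cst_continuous.
  by apply: powR_continuous; rewrite subr_gt0 ltr_pXn2r// nnegrE ltW// (lt_trans x0).
have GF (s : R) : 0 < s -> (G \o F) s * F^`()%classic s = k * shifted_weight q (1 / 2) z s.
  move=> s0; rewrite F'E// /G /= FF ?ltW// /F' /k /shifted_weight /gamma_weight.
  rewrite /z (addrC (x ^+ 2) s) addrK opprD expRD; ring.
have sub n : (\int[mu]_(t in `[F n.+1%:R^-1%R, F n.+1%:R%R]) (G t)%:E =
    \int[mu]_(s in `[n.+1%:R^-1%R, n.+1%:R%R]) (k * shifted_weight q (1 / 2) z s)%R%:E)%E.
  have u0 := invSn_gt0 n.
  have uv : n.+1%:R^-1 <= n.+1%:R :> R.
    by rewrite (@le_trans _ _ 1) ?invf_le1 ?ler1n.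
  have pos (s : R) : n.+1%:R^-1 < s -> 0 < s by exact: lt_trans.
  rewrite integration_by_substitution_increasing//.
  - apply: eq_integral => s; rewrite inE/= in_itv/= => /andP[us _].
    by rewrite -GF//; exact: lt_le_trans us.
  - move=> s t; rewrite !in_itv/= => /andP[us _] _; apply: F_lt.
    by rewrite ltW//; exact: lt_le_trans us.
  - by move=> s; rewrite in_itv/= => /andP[/pos + _]; exact: F1_cont.
  - by apply/cvg_ex; eexists; apply: cvg_at_right_filter; exact: F1_cont.
  - by apply/cvg_ex; eexists; apply: cvg_at_left_filter; exact: F1_cont.
  - split.
    + by move=> s; rewrite in_itv/= => /andP[/pos + _] => /dF[].
    + by apply: cvg_at_right_filter; exact: F_cont.
    + by apply: cvg_at_left_filter; exact: F_cont.
  - apply: continuous_in_subspaceT => t; rewrite inE/= in_itv/= => /andP[Ft _].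
    by apply: G_cont; apply: lt_le_trans Ft; exact: F_gtx.
have F_ndec (s t : R) : 0 <= s -> s <= t -> F s <= F t.
  by move=> s0; rewrite le_eqVlt => /predU1P[->//|st]; rewrite ltW// F_lt.
have cvgL : ((\int[mu]_(t in `[F n.+1%:R^-1%R, F n.+1%:R%R]) (G t)%:E)%E @[n --> \oo] -->
    \int[mu]_(t in `]x, +oo[) (G t)%:E)%E.
  apply: (@ge0_integral_half_line_cvg R x (fun n => F n.+1%:R^-1) (fun n => F n.+1%:R)).
  - by move=> n; exact/F_gtx/invSn_gt0.
  - by move=> m n mn; apply: F_ndec; [exact/ltW/invSn_gt0|exact: invSn_nonincreasing].
  - by move=> m n mn; apply: F_ndec => //; exact: Sn_nondecreasing.
  - have cF0 : {for (0 : R), continuous F}.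
      have zz : 0 < z + 0 by rewrite addr0.
      have [/derivable1_diffP + _] := @is_derive_powR_shift R z (1 / 2) 0 zz.
      exact: differentiable_continuous.
    rewrite -[X in _ --> X]F0.
    exact: (@cvg_comp _ _ _ (fun n : nat => n.+1%:R^-1 : R) F _ _ _ (@cvg_invSn R) cF0).
  - apply/cvgryPge => A; near=> n.
    have An : A ^+ 2 <= n.+1%:R.
      by near: n; move/cvgryPge : (@cvg_Sn R); apply.
    apply: (le_trans (ler_norm A)); rewrite -(@ler_pXn2r _ 2) ?nnegrE ?(ltW (F_gt0 _ _))//.
    by rewrite real_normK ?num_real// FF//; lra.
  - exact: half_line_measurable.
  - by move=> t _; rewrite mulr_ge0 ?expR_ge0 ?powR_ge0.
have cvgR : ((\int[mu]_(t in `[F n.+1%:R^-1%R, F n.+1%:R%R]) (G t)%:E)%E @[n --> \oo] -->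
    \int[mu]_(s in `]0%R, +oo[) (k * shifted_weight q (1 / 2) z s)%R%:E)%E.
  under eq_fun do rewrite sub.
  apply: (@ge0_integral_half_line_cvg R 0 (fun n => n.+1%:R^-1) (fun n => n.+1%:R)).
  - exact: invSn_gt0.
  - exact: invSn_nonincreasing.
  - exact: Sn_nondecreasing.
  - exact: cvg_invSn.
  - exact: cvg_Sn.
  - apply: half_line_measurable => s s0; apply: continuousM; first exact: cst_continuous.
    exact: shifted_weight_continuous.
  - by move=> t _; rewrite mulr_ge0 ?shifted_weight_ge0.
rewrite -RintegralZl//; last by apply: shifted_weight_integrable => //; lra.
by congr fine; exact: (cvg_unique _ cvgL cvgR).
Unshelve. all: by end_near. Qed.

Lemma V_momentE (q x : R) : -1 < q -> 0 < x ->
  V q x = (Gamma (q + 1))^-1 * moment q (1 / 2) (x ^+ 2).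
Proof.
move=> q1 x0; rewrite /V V_integralE// expRN.
by field; rewrite !gt_eqF ?expR_gt0 ?Gamma_gt0.
Qed.

End Representation.

(** * Monotonicity of the slopes *)

Section MomentMonotonicity.
Context {R : realType}.
Implicit Types q p z x : R.
Notation m q p := (moment q p).

Lemma moment_decreasing q p (x y : R) : -1 < q -> 0 < p -> 0 < x -> x < y ->
  m q p y < m q p x.
Proof.
move=> q1 p0 x0 xy.
pose dm z := - (- p * m q (p + 1) z).
have itvE z : (z \in `]0, +oo[) = (0 < z) by rewrite in_itv/= andbT.
have := @positive_derivative_increasing R (fun z => - m q p z) dm `]0, +oo[.
move=> /(_ _ _ x y); rewrite !itvE ltrN2; apply => //.
- move=> z; rewrite itvE => z0; apply: is_deriveN; apply: is_derive_moment => //; lra.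
- move=> z; rewrite itvE => z0; rewrite /dm mulNr opprK mulr_gt0//.
  by apply: moment_gt0 => //; lra.
- exact: lt_trans xy.
Qed.

(** The slope of [- ln V(e^w)] at [w] is this function at [z = e^(2 w)]. After
    elimination with the recurrence, the numerator of its derivative is
    [I_(-1/2) I_(3/2) - I_(1/2)^2], positive by Cauchy-Schwarz. *)
Lemma elasticity_increasing q : -1 < q ->
  {in `]0, +oo[ &, {homo (fun z => z * m q (1 / 2 + 1) z / m q (1 / 2) z) : x y / x < y}}.
Proof.
move=> q1.
pose A := m q (1 / 2); pose D := m q (1 / 2 + 1); pose E := m q (1 / 2 + 1 + 1).
apply: (@positive_derivative_increasing R _ (fun z =>
  ((D z - (1 / 2 + 1) * z * E z) * A z + 1 / 2 * z * D z ^+ 2) / A z ^+ 2)) => z;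
  rewrite in_itv/= andbT => z0.
  have A0 : 0 < A z by apply: moment_gt0 => //; lra.
  have dA : is_derive z 1 A _ := is_derive_moment q (1 / 2) z q1 ltac:(lra) z0.
  have dD : is_derive z 1 D _ := is_derive_moment q (1 / 2 + 1) z q1 ltac:(lra) z0.
  have dV := is_deriveV (lt0r_neq0 A0) dA.
  have d := is_deriveM (is_deriveM (is_derive_id z (1 : R)) dD) dV.
  apply: (is_derive_eq d); rewrite /GRing.scale/= ?fctE -/A -/D -/E.
  by field; rewrite gt_eqF.
have A0 : 0 < A z by apply: moment_gt0 => //; lra.
have r1 : 1 / 2 * (z * D z - A z) = m q (1 / 2 - 1) z - (z + q + 1) * A z.
  by apply: moment_recurrence => //; lra.
have r2 : (1 / 2 + 1) * (z * E z - D z) = A z - (z + q + 1) * D z.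
  by have := @moment_recurrence R q (1 / 2 + 1) z q1; rewrite addrK; apply; lra.
have cs : A z ^+ 2 < m q (1 / 2 - 1) z * D z.
  by apply: moment_cauchy_schwarz => //; lra.
rewrite divr_gt0 ?exprn_gt0//.
set B := m q (1 / 2 - 1) z in r1 cs.
have r1' : B = (z + q + 1) * A z + 1 / 2 * (z * D z - A z) by lra.
have r2' : (1 / 2 + 1) * z * E z = A z - (z + q + 1) * D z + (1 / 2 + 1) * D z by lra.
rewrite r1' in cs; rewrite r2'; rewrite -subr_gt0 in cs; apply: (lt_le_trans cs).
by rewrite le_eqVlt; apply/orP; left; apply/eqP; field.
Qed.

(** The function is the logarithmic derivative of I_(1/2); its derivative is
    positive because [I_(3/2)^2 < I_(1/2) I_(5/2)]. *)
Lemma log_derivative_increasing q : -1 < q ->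
  {in `]0, +oo[ &, {homo (fun z => - (1 / 2) * m q (1 / 2 + 1) z / m q (1 / 2) z) : x y / x < y}}.
Proof.
move=> q1.
pose A := m q (1 / 2); pose D := m q (1 / 2 + 1); pose E := m q (1 / 2 + 1 + 1).
apply: (@positive_derivative_increasing R _ (fun z =>
  1 / 2 * ((1 / 2 + 1) * E z * A z - 1 / 2 * D z ^+ 2) / A z ^+ 2)) => z;
  rewrite in_itv/= andbT => z0.
  have A0 : 0 < A z by apply: moment_gt0 => //; lra.
  have dA : is_derive z 1 A _ := is_derive_moment q (1 / 2) z q1 ltac:(lra) z0.
  have dD : is_derive z 1 D _ := is_derive_moment q (1 / 2 + 1) z q1 ltac:(lra) z0.
  have dV := is_deriveV (lt0r_neq0 A0) dA.
  have d := is_deriveM (is_deriveZ (- (1 / 2)) dD) dV.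
  apply: (is_derive_eq d); rewrite /GRing.scale/= ?fctE -/A -/D -/E.
  by rewrite /GRing.scale/=; field; rewrite gt_eqF.
have A0 : 0 < A z by apply: moment_gt0 => //; lra.
have D0 : 0 < D z by apply: moment_gt0 => //; lra.
have cs : D z ^+ 2 < A z * E z.
  by have := @moment_cauchy_schwarz R q (1 / 2 + 1) z q1; rewrite addrK; apply; lra.
rewrite divr_gt0 ?exprn_gt0//.
have := exprn_gt0 2 D0; lra.
Qed.

Lemma is_derive_moment_sqr q p x : -1 < q -> -1 <= p -> 0 < x ->
  is_derive x 1 (fun x => m q p (x ^+ 2)) (- p * m q (p + 1) (x ^+ 2) * (2 * x)).
Proof.
move=> q1 p1 x0.
apply: (@is_derive1_comp _ (m q p) (fun x => x ^+ 2)).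
  by apply: is_derive_moment => //; rewrite exprn_gt0.
have d := is_deriveX 2 (is_derive_id x (1 : R)).
by apply: (is_derive_eq d); rewrite /GRing.scale/= expr1 mulr1.
Qed.

(** The slope of [V(1/u)] is, up to a positive constant, this function at
    [x = 1/u]. *)
Lemma V_comp_inv_slope_increasing q : -1 < q ->
  {in `]0, +oo[ &, {homo (fun x => x ^+ 3 * m q (1 / 2 + 1) (x ^+ 2)) : x y / x < y}}.
Proof.
move=> q1.
apply: (@positive_derivative_increasing R _ (fun x => 3 * x ^+ 2 *
  (m q (1 / 2 + 1) (x ^+ 2) - x ^+ 2 * m q (1 / 2 + 1 + 1) (x ^+ 2)))) => x;
  rewrite in_itv/= andbT => x0.
  have d1 := is_deriveX 3 (is_derive_id x (1 : R)).
  have dD := is_derive_moment_sqr q (1 / 2 + 1) x q1 ltac:(lra) x0.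
  have d := is_deriveM d1 dD.
  by apply: (is_derive_eq d); rewrite /GRing.scale/= ?fctE; field.
rewrite !mulr_gt0 ?exprn_gt0// subr_gt0.
by apply: moment_shift_lt; rewrite ?exprn_gt0//; lra.
Qed.

(** The expression P(z) has the sign of the second derivative of [1 / V] at
    [x = sqrt z], and it is the delicate point. The weighted quantity
    [H = I_(1/2) P e^(-z) z^(-q)] satisfies
    [H' = - e^(-z) z^(-q) (z I_(3/2)^3 / 2 + q I_(1/2)^2 I_(3/2) / (2 z))],
    which is negative as [0 <= q]. It is therefore strictly decreasing, and its
    lower limit at infinity is nonnegative because of the factor [e^(-z)]; hence
    it is positive. *)
Lemma reciprocal_discriminant_gt0 q z : 0 <= q -> 0 < z ->
  0 < z * m q (1 / 2 + 1) z ^+ 2 + (z + q) * m q (1 / 2) z * m q (1 / 2 + 1) z - m q (1 / 2) z ^+ 2.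
Proof.
move=> q0 z0; have q1 : -1 < q by lra.
pose A := m q (1 / 2); pose D := m q (1 / 2 + 1); pose E := m q (1 / 2 + 1 + 1).
pose P z := z * D z ^+ 2 + (z + q) * A z * D z - A z ^+ 2.
pose w z := expR (- z) * z `^ (- q).
pose H z := A z * P z * w z.
have A0 t : 0 < t -> 0 < A t by move=> t0; apply: moment_gt0 => //; lra.
have D0 t : 0 < t -> 0 < D t by move=> t0; apply: moment_gt0 => //; lra.
have w0 t : 0 < t -> 0 < w t by move=> t0; rewrite mulr_gt0 ?expR_gt0 ?powR_gt0.
have itvE t : (t \in `]0, +oo[) = (0 < t) by rewrite in_itv/= andbT.
have H_decr (x y : R) : 0 < x -> x < y -> H y < H x.
  move=> x0 xy; pose h t := w t * (t * D t ^+ 3 / 2 + q / (2 * t) * A t ^+ 2 * D t).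
  have := @positive_derivative_increasing R (fun t => - H t) h `]0, +oo[.
  move=> /(_ _ _ x y); rewrite !itvE ltrN2; apply => //; last exact: lt_trans xy.
  - move=> t; rewrite itvE => t0.
    have dA : is_derive t 1 A _ := is_derive_moment q (1 / 2) t q1 ltac:(lra) t0.
    have dD : is_derive t 1 D _ := is_derive_moment q (1 / 2 + 1) t q1 ltac:(lra) t0.
    have did := is_derive_id t (1 : R).
    have dtq := is_deriveD did (is_derive_cst q t (1 : R)).
    have dP := is_deriveB (is_deriveD (is_deriveM did (is_deriveX 2 dD))
      (is_deriveM (is_deriveM dtq dA) dD)) (is_deriveX 2 dA).
    have dw := is_deriveM (is_derive_expRN t) (@is_derive1_powR _ (- q) t t0).
    have d := is_deriveN (is_deriveM (is_deriveM dA dP) dw).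
    apply: (is_derive_eq d); rewrite /GRing.scale/= ?fctE -/A -/D -/E /h /w.
    have r : (1 / 2 + 1) * (t * E t - D t) = A t - (t + q + 1) * D t.
      by have := @moment_recurrence R q (1 / 2 + 1) t q1; rewrite addrK; apply; lra.
    (* The recurrence removes the moment of order 5/2. *)
    have -> : E t = (2 / 3 * (A t - (t + q + 1) * D t) + D t) / t.
      have : t * E t = 2 / 3 * (A t - (t + q + 1) * D t) + D t by lra.
      by move=> <-; field; rewrite gt_eqF.
    have -> : t `^ (- q - 1) = t `^ (- q) / t.
      by rewrite powRB ?(gt_eqF t0) ?implybT// powRr1 ?ltW.
    by field; rewrite gt_eqF.
  - move=> t; rewrite itvE => t0; rewrite mulr_gt0 ?w0//.
    apply: ltr_wpDr; last by rewrite !mulr_gt0 ?invr_gt0 ?exprn_gt0 ?D0.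
    by rewrite mulr_ge0 ?(ltW (D0 _ t0))// mulr_ge0 ?sqr_ge0// divr_ge0// mulr_ge0 ?ltW.
(* Only P >= - A^2 is used, and expR (- t) <= (1 + t)^-1 suffices for the limit. *)
have H_lb t : 1 <= t -> - (A 1 ^+ 3 / (1 + t)) <= H t.
  move=> t1; have t0 : 0 < t by lra.
  have w1 : w t <= (1 + t)^-1.
    rewrite /w expRN -[leRHS]mulr1; apply: ler_pM; rewrite ?invr_ge0 ?expR_ge0 ?powR_ge0//.
      by rewrite lef_pV2 ?posrE ?expR_gt0 ?expR_ge1Dx//; lra.
    by rewrite powRN invf_le1 ?powR_gt0// -[leLHS](powRr0 t); exact: ler_powR.
  have A1 : A t <= A 1.
    move: t1; rewrite le_eqVlt => /predU1P[<-//|t1]; apply/ltW.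
    by apply: moment_decreasing => //; lra.
  have At := A0 t t0; have wt := w0 t t0; have Dt := D0 t t0.
  have P1 : - A t ^+ 2 <= P t.
    rewrite /P -subr_ge0 opprK addrNK addr_ge0//.
      by rewrite mulr_ge0 ?sqr_ge0 ?ltW.
    exact: (mulr_ge0 (mulr_ge0 (addr_ge0 (ltW t0) q0) (ltW At)) (ltW Dt)).
  apply: (@le_trans _ _ (- (A t ^+ 3 * w t))).
    rewrite lerN2; have A3 := lerXn2r 3 (ltW At) (ltW (A0 1 ltr01)) A1.
    exact: (ler_pM (exprn_ge0 3 (ltW At)) (ltW wt) A3 w1).
  have := ler_wpM2r (ltW wt) (ler_wpM2l (ltW At) P1).
  by apply: le_trans; rewrite le_eqVlt; apply/orP; left; apply/eqP; ring.
have : 0 < H z.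
  rewrite ltNge; apply/negP => Hz.
  have He : H (z + 1) < 0 by apply: (lt_le_trans _ Hz); apply: H_decr; lra.
  set e := - H (z + 1); have e0 : 0 < e by rewrite /e oppr_gt0.
  have A1 := A0 1 ltr01.
  have Ae : 0 < A 1 ^+ 3 / e by rewrite divr_gt0 ?exprn_gt0.
  (* At this point the lower bound on H exceeds - e = H (z + 1). *)
  pose t := z + 1 + A 1 ^+ 3 / e.
  have Ht : H t < H (z + 1) by apply: H_decr; rewrite /t; lra.
  have := H_lb t; rewrite /t => /(_ ltac:(lra)); rewrite -/t => lb.
  have : A 1 ^+ 3 / (1 + t) < e.
    rewrite ltr_pdivrMr; last by rewrite /t; lra.
    have -> : e * (1 + t) = e * (1 + z + 1) + A 1 ^+ 3 by rewrite /t; field; rewrite gt_eqF.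
    by rewrite ltrDr mulr_gt0//; lra.
  by rewrite /e; lra.
by rewrite /H pmulr_lgt0 ?w0// pmulr_rgt0 ?A0.
Qed.

(** The function is, up to a positive constant, the slope of [1 / V]. *)
Lemma inv_V_slope_increasing q : 0 <= q ->
  {in `]0, +oo[ &, {homo (fun x => x * m q (1 / 2 + 1) (x ^+ 2) / m q (1 / 2) (x ^+ 2) ^+ 2) :
     x y / x < y}}.
Proof.
move=> q0; have q1 : -1 < q by lra.
pose A x := m q (1 / 2) (x ^+ 2); pose D x := m q (1 / 2 + 1) (x ^+ 2).
apply: (@positive_derivative_increasing R _ (fun x =>
  2 * (x ^+ 2 * D x ^+ 2 + (x ^+ 2 + q) * A x * D x - A x ^+ 2) / A x ^+ 3)) => x;
  rewrite in_itv/= andbT => x0.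
  have x20 : 0 < x ^+ 2 by rewrite exprn_gt0.
  have A0 : 0 < A x by apply: moment_gt0 => //; lra.
  have dA : is_derive x 1 A _ := is_derive_moment_sqr q (1 / 2) x q1 ltac:(lra) x0.
  have dD : is_derive x 1 D _ := is_derive_moment_sqr q (1 / 2 + 1) x q1 ltac:(lra) x0.
  have dV := @is_deriveV _ (A ^+ 2) x _ 1 (lt0r_neq0 (exprn_gt0 2 A0)) (is_deriveX 2 dA).
  have d := is_deriveM (is_deriveM (is_derive_id x (1 : R)) dD) dV.
  apply: (is_derive_eq d); rewrite /GRing.scale/= ?fctE -/(A x) -/(D x).
  set E := m q (1 / 2 + 1 + 1) (x ^+ 2).
  have r : (1 / 2 + 1) * (x ^+ 2 * E - D x) = A x - (x ^+ 2 + q + 1) * D x.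
    by have := @moment_recurrence R q (1 / 2 + 1) (x ^+ 2) q1; rewrite addrK; apply; lra.
  have -> : E = (2 / 3 * (A x - (x ^+ 2 + q + 1) * D x) + D x) / x ^+ 2.
    have : x ^+ 2 * E = 2 / 3 * (A x - (x ^+ 2 + q + 1) * D x) + D x by lra.
    by move=> <-; field; rewrite gt_eqF.
  by field; rewrite !gt_eqF.
have x20 : 0 < x ^+ 2 by rewrite exprn_gt0.
have A0 : 0 < A x by apply: moment_gt0 => //; lra.
by rewrite divr_gt0 ?exprn_gt0// mulr_gt0// reciprocal_discriminant_gt0.
Qed.

End MomentMonotonicity.

(** * The four extreme pairs of orders *)

Section CoreInequalities.
Context {R : realType}.
Implicit Types a b q x y alpha : R.

Definition unnormalized_V q x := moment q (1 / 2) (x ^+ 2).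

Lemma unnormalized_V_gt0 q x : -1 < q -> 0 < x -> 0 < unnormalized_V q x.
Proof. by move=> q1 x0; apply: moment_gt0; rewrite ?exprn_gt0//; lra. Qed.

Lemma is_derive_unnormalized_V q x : -1 < q -> 0 < x ->
  is_derive x 1 (unnormalized_V q) (- x * moment q (1 / 2 + 1) (x ^+ 2)).
Proof.
move=> q1 x0; have d := is_derive_moment_sqr q (1 / 2) x q1 ltac:(lra) x0.
by apply: (is_derive_eq d); field.
Qed.

Lemma unnormalized_V_decreasing q x y : -1 < q -> 0 < x -> x <= y ->
  unnormalized_V q y <= unnormalized_V q x.
Proof.
move=> q1 x0; rewrite le_eqVlt => /predU1P[<-//|xy]; apply/ltW.
apply: moment_decreasing; rewrite ?exprn_gt0//.
by rewrite ltr_pXn2r// nnegrE ltW// (lt_trans x0).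
Qed.

Lemma itv_pos (x : R) : (x \in `]0, +oo[) = (0 < x).
Proof. by rewrite in_itv/= andbT. Qed.

(** Concavity of [ln V(e^w)] in [w]. *)
Lemma unnormalized_V_00_concave q x y alpha : -1 < q ->
  0 < x -> 0 < y -> x <> y -> 0 < alpha < 1 ->
  power_mean 0 alpha (unnormalized_V q x) (unnormalized_V q y) <
    unnormalized_V q (power_mean 0 alpha x y).
Proof.
move=> q1 x0 y0 xy al.
have Vx := unnormalized_V_gt0 q _ q1 x0; have Vy := unnormalized_V_gt0 q _ q1 y0.
pose r z := z * moment q (1 / 2 + 1) z / moment q (1 / 2) z.
have h := @strictly_increasing_derivative_convex R (fun w => - ln (unnormalized_V q (expR w)))
  (fun w => r (expR w ^+ 2)) `]-oo, +oo[.
have dh (w : R) : is_derive w 1 (fun w => - ln (unnormalized_V q (expR w))) (r (expR w ^+ 2)).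
  have e0 := expR_gt0 w.
  have d1 := @is_derive1_comp _ (unnormalized_V q) expR w _ _
    (is_derive_unnormalized_V q _ q1 e0) (is_derive_expR w).
  have d2 := @is_derive1_comp _ (@ln R) (unnormalized_V q \o expR) w _ _
    (is_derive1_ln (unnormalized_V_gt0 q _ q1 e0)) d1.
  apply: (is_derive_eq (is_deriveN d2)).
  have := unnormalized_V_gt0 q _ q1 e0; rewrite /r /= /unnormalized_V.
  move: (moment q (1 / 2) _) => A A0.
  move: (moment q (1 / 2 + 1) _) => D; move: (expR w) => e.
  by field; rewrite gt_eqF.
have rh : {in `]-oo, +oo[ &, {homo (fun w : R => r (expR w ^+ 2)) : x y / x < y}}.
  move=> u v _ _ uv; apply: elasticity_increasing; rewrite ?itv_pos ?exprn_gt0 ?expR_gt0//.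
  by rewrite ltr_pXn2r ?nnegrE ?expR_ge0// ltr_expR.
have {}h := h (fun w _ => dh w) rh (ln x) (ln y) alpha.
have Hxy : ln x <> ln y by move=> /ln_inj; rewrite !posrE => /(_ x0 y0).
have {}h := h ltac:(by rewrite in_itv) ltac:(by rewrite in_itv) Hxy al.
rewrite -(power_mean0_expR alpha x y x0 y0) (lnK x0) (lnK y0) in h.
rewrite -ltr_ln ?posrE ?power_mean_gt0 ?unnormalized_V_gt0 ?power_mean_gt0//.
rewrite !mulrN -opprD ltrN2 in h.
by rewrite (ln_power_mean0 alpha _ _ Vx Vy).
Qed.

(** Concavity of [V(1/u)] in [u]. *)
Lemma unnormalized_V_N11_concave q x y alpha : -1 < q ->
  0 < x -> 0 < y -> x <> y -> 0 < alpha < 1 ->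
  power_mean 1 alpha (unnormalized_V q x) (unnormalized_V q y) <
    unnormalized_V q (power_mean (-1) alpha x y).
Proof.
move=> q1 x0 y0 xy al.
have Vx := unnormalized_V_gt0 q _ q1 x0; have Vy := unnormalized_V_gt0 q _ q1 y0.
pose psi x := x ^+ 3 * moment q (1 / 2 + 1) (x ^+ 2).
have h := @strictly_increasing_derivative_convex R (fun u => - unnormalized_V q u^-1)
  (fun u => - psi u^-1) `]0, +oo[.
have dh (u : R) : u \in `]0, +oo[ -> is_derive u 1 (fun u => - unnormalized_V q u^-1) (- psi u^-1).
  rewrite itv_pos => u0; have i0 : 0 < u^-1 by rewrite invr_gt0.
  have dV := is_deriveV (lt0r_neq0 u0) (is_derive_id u (1 : R)).
  have d1 := @is_derive1_comp _ (unnormalized_V q) (fun u => u^-1) u _ _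
    (is_derive_unnormalized_V q _ q1 i0) dV.
  apply: (is_derive_eq (is_deriveN d1)); rewrite /psi /GRing.scale/=.
  by field; rewrite gt_eqF.
have rh : {in `]0, +oo[ &, {homo (fun u : R => - psi u^-1) : x y / x < y}}.
  move=> u v; rewrite !itv_pos => u0 v0 uv; rewrite ltrN2.
  by apply: V_comp_inv_slope_increasing; rewrite ?itv_pos ?invr_gt0// ltf_pV2.
have Hxy : x^-1 <> y^-1 by move=> /invr_inj.
have {}h := h dh rh x^-1 y^-1 alpha ltac:(by rewrite itv_pos invr_gt0)
  ltac:(by rewrite itv_pos invr_gt0) Hxy al.
rewrite !invrK !mulrN -opprD ltrN2 in h.
by rewrite (power_mean1 alpha _ _ al Vx Vy) (power_meanN1 alpha _ _ al x0 y0).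
Qed.

(** Convexity of [ln V(sqrt z)] in [z]. *)
Lemma unnormalized_V_20_convex q x y alpha : -1 < q ->
  0 < x -> 0 < y -> x <> y -> 0 < alpha < 1 ->
  unnormalized_V q (power_mean 2 alpha x y) <
    power_mean 0 alpha (unnormalized_V q x) (unnormalized_V q y).
Proof.
move=> q1 x0 y0 xy al; have p1 : -1 <= 1 / 2 :> R by lra.
have Vx := unnormalized_V_gt0 q _ q1 x0; have Vy := unnormalized_V_gt0 q _ q1 y0.
have dh (z : R) : z \in `]0, +oo[ -> is_derive z 1 (fun z => ln (moment q (1 / 2) z))
    (- (1 / 2) * moment q (1 / 2 + 1) z / moment q (1 / 2) z).
  rewrite itv_pos => z0; have m0 := moment_gt0 q (1 / 2) z q1 p1 z0.
  have d1 := is_derive_moment q (1 / 2) z q1 p1 z0.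
  have d2 := @is_derive1_comp _ (@ln R) (moment q (1 / 2)) z _ _ (is_derive1_ln m0) d1.
  by apply: (is_derive_eq d2); rewrite mulrC.
have h := @strictly_increasing_derivative_convex R (fun z => ln (moment q (1 / 2) z))
  (fun z => - (1 / 2) * moment q (1 / 2 + 1) z / moment q (1 / 2) z) `]0, +oo[.
have Hxy : x ^+ 2 <> y ^+ 2.
  by move=> /eqP; rewrite eqrXn2 ?ltW// => /eqP.
have {}h := h dh (log_derivative_increasing q q1) (x ^+ 2) (y ^+ 2) alpha
  ltac:(by rewrite itv_pos exprn_gt0) ltac:(by rewrite itv_pos exprn_gt0) Hxy al.
rewrite -ltr_ln ?posrE ?power_mean_gt0 ?unnormalized_V_gt0 ?power_mean_gt0//.
by rewrite (ln_power_mean0 alpha _ _ Vx Vy) /unnormalized_V (power_mean2_sqr _ _ _ al x0 y0).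
Qed.

(** Convexity of [1 / V]. *)
Lemma unnormalized_V_1N1_concave q x y alpha : 0 <= q ->
  0 < x -> 0 < y -> x <> y -> 0 < alpha < 1 ->
  power_mean (-1) alpha (unnormalized_V q x) (unnormalized_V q y) <
    unnormalized_V q (power_mean 1 alpha x y).
Proof.
move=> q0 x0 y0 xy al; have q1 : -1 < q by lra.
have Vx := unnormalized_V_gt0 q _ q1 x0; have Vy := unnormalized_V_gt0 q _ q1 y0.
pose g x := x * moment q (1 / 2 + 1) (x ^+ 2) / unnormalized_V q x ^+ 2.
have h := @strictly_increasing_derivative_convex R (fun x => (unnormalized_V q x)^-1) g `]0, +oo[.
have dh (u : R) : u \in `]0, +oo[ -> is_derive u 1 (fun x => (unnormalized_V q x)^-1) (g u).
  rewrite itv_pos => u0; have V0 := unnormalized_V_gt0 q u q1 u0.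
  have d1 := is_deriveV (lt0r_neq0 V0) (is_derive_unnormalized_V q u q1 u0).
  by apply: (is_derive_eq d1); rewrite /g /GRing.scale/=; field; rewrite gt_eqF.
have {}h := h dh (inv_V_slope_increasing q q0) x y alpha
  ltac:(by rewrite itv_pos) ltac:(by rewrite itv_pos) xy al.
have M0 := power_mean_gt0 1 alpha x y al x0 y0.
rewrite (power_mean1 alpha x y al x0 y0) in M0 *.
rewrite (power_meanN1 alpha _ _ al Vx Vy).
have VM := unnormalized_V_gt0 q _ q1 M0.
have S0 : 0 < alpha * (unnormalized_V q x)^-1 + (1 - alpha) * (unnormalized_V q y)^-1.
  have /andP[a0 a1] := al; have b0 : 0 < 1 - alpha by rewrite subr_gt0.
  by apply: addr_gt0; apply: mulr_gt0; rewrite ?invr_gt0; [exact: a0|exact: Vx|exact: b0|exact: Vy].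
by rewrite (invf_plt S0 VM); exact: h.
Qed.

Lemma V_positive_continuous q : -1 < q -> positive_continuous_on `]0, +oo[ (V q).
Proof.
move=> q1; have G0 := Gamma_gt0 q q1; split => //.
- exact: interval_is_interval.
- move=> x /=; rewrite in_itv/= andbT => x0.
  by rewrite V_momentE// mulr_gt0 ?invr_gt0//; exact: unnormalized_V_gt0.
- apply: continuous_in_subspaceT => x; rewrite inE/= in_itv/= andbT => x0.
  suff : V q t @[t --> x] --> V q x by [].
  rewrite V_momentE//.
  have cV : {for x, continuous (unnormalized_V q)}.
    have [/derivable1_diffP + _] := is_derive_unnormalized_V q x q1 x0.
    exact: differentiable_continuous.
  have c : (Gamma (q + 1))^-1 * unnormalized_V q t @[t --> x] -->
      (Gamma (q + 1))^-1 * unnormalized_V q x.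
    exact: cvgMr.
  apply: cvg_trans c; apply: near_eq_cvg; near=> t.
  by rewrite V_momentE//; near: t; exact: lt_nbhsr.
Unshelve. all: by end_near. Qed.

(** As V decreases and power means increase with their order, lowering either
    order preserves concavity; power means being homogeneous, the normalising
    gamma factor is harmless. *)
Lemma V_strictly_concave a b a0 b0 q : -1 < q -> a <= a0 -> b <= b0 ->
  (forall x y alpha, 0 < x -> 0 < y -> x <> y -> 0 < alpha < 1 ->
    power_mean b0 alpha (unnormalized_V q x) (unnormalized_V q y) <
    unnormalized_V q (power_mean a0 alpha x y)) ->
  strictly_ab_concave a b `]0, +oo[ (V q).
Proof.
move=> q1 aa bb core; split; first exact: V_positive_continuous.
move=> x y alpha /=; rewrite !in_itv/= !andbT => x0 y0 xy al.
have k0 : 0 < (Gamma (q + 1))^-1 by rewrite invr_gt0 Gamma_gt0.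
have M0 := power_mean_gt0 a alpha x y al x0 y0.
have Vx := unnormalized_V_gt0 q x q1 x0; have Vy := unnormalized_V_gt0 q y q1 y0.
rewrite (V_momentE q x q1 x0) (V_momentE q y q1 y0) (V_momentE q _ q1 M0).
rewrite -!/(unnormalized_V q _) (power_meanZ b alpha _ _ _ al k0 Vx Vy) (ltr_pM2l k0).
apply: le_lt_trans (power_mean_le b b0 alpha _ _ bb al Vx Vy) _.
apply: lt_le_trans (core _ _ _ x0 y0 xy al) _.
exact: unnormalized_V_decreasing q1 M0 (power_mean_le a a0 alpha x y aa al x0 y0).
Qed.

Lemma V_strictly_convex a b a0 b0 q : -1 < q -> a0 <= a -> b0 <= b ->
  (forall x y alpha, 0 < x -> 0 < y -> x <> y -> 0 < alpha < 1 ->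
    unnormalized_V q (power_mean a0 alpha x y) <
      power_mean b0 alpha (unnormalized_V q x) (unnormalized_V q y)) ->
  strictly_ab_convex a b `]0, +oo[ (V q).
Proof.
move=> q1 aa bb core; split; first exact: V_positive_continuous.
move=> x y alpha /=; rewrite !in_itv/= !andbT => x0 y0 xy al.
have k0 : 0 < (Gamma (q + 1))^-1 by rewrite invr_gt0 Gamma_gt0.
have M0 := power_mean_gt0 a alpha x y al x0 y0.
have M00 := power_mean_gt0 a0 alpha x y al x0 y0.
have Vx := unnormalized_V_gt0 q x q1 x0; have Vy := unnormalized_V_gt0 q y q1 y0.
rewrite (V_momentE q x q1 x0) (V_momentE q y q1 y0) (V_momentE q _ q1 M0).
rewrite -!/(unnormalized_V q _) (power_meanZ b alpha _ _ _ al k0 Vx Vy) (ltr_pM2l k0).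
apply: lt_le_trans (power_mean_le b0 b alpha _ _ bb al Vx Vy).
apply: le_lt_trans (core _ _ _ x0 y0 xy al).
exact: unnormalized_V_decreasing q1 M00 (power_mean_le a0 a alpha x y aa al x0 y0).
Qed.

End CoreInequalities.

Theorem theorem3 (R : realType) :
  (forall a b q : R, a <= 0 -> b <= 0 -> -1 < q ->
     strictly_ab_concave a b `]0, +oo[ (V q)) /\
  (forall a b q : R, b <= 1 -> -1 < q -> a <= -1 ->
     strictly_ab_concave a b `]0, +oo[ (V q)) /\
  (forall a b q : R, 2 <= a -> 1 <= b -> 0 <= q ->
     strictly_ab_convex a b `]0, +oo[ (V q)) /\
  (forall a b q : R, 2 <= a -> 0 <= b -> 0 <= q ->
     strictly_ab_convex a b `]0, +oo[ (V q)) /\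
  (forall a b q : R, a <= 1 -> b <= -1 -> 0 <= q ->
     strictly_ab_concave a b `]0, +oo[ (V q)).
Proof.
have log_convex (a b q : R) : 2 <= a -> 0 <= b -> 0 <= q ->
    strictly_ab_convex a b `]0, +oo[ (V q).
  move=> ha hb hq; apply: (@V_strictly_convex R a b 2 0) => //; first lra.
  by move=> *; apply: unnormalized_V_20_convex => //; lra.
split; [|split; [|split; [|split]]] => a b q.
- move=> ha hb hq; apply: (@V_strictly_concave R a b 0 0) => // *.
  exact: unnormalized_V_00_concave.
- move=> hb hq ha; apply: (@V_strictly_concave R a b (-1) 1) => // *.
  exact: unnormalized_V_N11_concave.
- by move=> ha hb hq; apply: log_convex => //; lra.
- exact: log_convex.
- move=> ha hb hq; apply: (@V_strictly_concave R a b 1 (-1)) => //; first lra.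
  by move=> *; exact: unnormalized_V_1N1_concave.
Qed.
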